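(* Let $M_\preceq=(S,\Sigma,T,\mathbf{E},\mathbf{D})$ be a monotonic MDP with $T=\{\tau_1,\dots,\tau_m\}$, let $\lambda$ be a memoryless strategy, and let $B,C\subseteq S$. Then the output of $\textsc{Split}(B,C,\lambda)$ is a partition $\{B_1,\dots,B_k\}$ of $B$ such that for all $s,s'\in B$, $s$ and $s'$ lie in the same $B_l$ if and only if $\mathbf{P}_\lambda(s,C)=\mathbf{P}_\lambda(s',C)$.
   Context: An MDP is a tuple $(S,\Sigma,T,\mathbf{E},\mathbf{D})$ where $S$ is a finite set of states, $\Sigma$ and $T$ are disjoint finite sets of actions, $\mathbf{E}$ is a partial function assigning to some pairs $(s,\sigma)$ a total function $\mathbf{E}(s,\sigma):T\to S$, and $\mathbf{D}$ a partial function with the same domain assigning a probability distribution on $T$; $\Sigma_s=\{\sigma\mid(s,\sigma)\text{ in the domain}\}\neq\emptyset$ for all $s$. It is monotonic if (1) $S$ carries a partial order $\preceq$ such that any two elements have a greatest lower bound, and (2) for all $s\preceq s'$, $\sigma,\tau$, $t'$ with $\mathbf{E}(s',\sigma)(\tau)=t'$, there is $t$ with $\mathbf{E}(s,\sigma)(\tau)=t\preceq t'$. A memoryless strategy is a map $\lambda:S\to\Sigma$ with $\lambda(s)\in\Sigma_s$. Write $\mathbf{E}_\lambda(s)=\mathbf{E}(s,\lambda(s))$, $\mathbf{D}_\lambda(s)=\mathbf{D}(s,\lambda(s))$, and $\mathbf{P}_\lambda(s,C)=\sum_{\tau\in T,\ \mathbf{E}_\lambda(s)(\tau)\in C}\mathbf{D}_\lambda(s)(\tau)$.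 Let $\mathsf{Pre}_\lambda(C,\tau)=\{s\in S\mid \mathbf{E}_\lambda(s)(\tau)\in C\}$. Let $\mathcal{P}_{\mathbf{D},\lambda}$ be the partition of $S$ into classes of the relation $s\sim s'$ iff $\mathbf{D}_\lambda(s)=\mathbf{D}_\lambda(s')$, and for a class $D$ write $\mathbf{D}_\lambda(D)$ for the common distribution. Algorithm $\textsc{Split}(B,C,\lambda)$ maintains a table $P$, a finite map from real numbers to subsets of $S$. Initially $P$ maps $0$ to $B$. For $i=1,\dots,m$: start a new table $P_{\mathrm{new}}$ mapping every key to $\emptyset$; for each entry $(p,\mathit{block})$ of $P$, add $\mathit{block}\setminus\mathsf{Pre}_\lambda(C,\tau_i)$ (by union) to $P_{\mathrm{new}}[p]$, and for each $D\in\mathcal{P}_{\mathbf{D},\lambda}$ add $\mathit{block}\cap D\cap\mathsf{Pre}_\lambda(C,\tau_i)$ (by union) to $P_{\mathrm{new}}[p+\mathbf{D}_\lambda(D)(\tau_i)]$; then set $P$ to $P_{\mathrm{new}}$ with all entries having empty set removed. The output is the set of sets stored in the final table $P$. *)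

(* Defs.v *)
From HB Require Import structures.
From mathcomp Require Import all_boot all_order all_algebra.
From mathcomp Require Import finmap reals.

Set Implicit Arguments.
Unset Strict Implicit.
Unset Printing Implicit Defensive.

Import Order.TTheory GRing.Theory Num.Theory.

Local Open Scope ring_scope.

Record distr (R : realType) (T : finType) := Distr {
  mass :> {ffun T -> R};
  distrP : [forall t, 0 <= mass t] && (\sum_t mass t == 1)
}.

HB.instance Definition _ (R : realType) (T : finType) :=
  [isSub for @mass R T].
HB.instance Definition _ (R : realType) (T : finType) :=
  [Equality of distr R T by <:].

Definition oget (A : Type) (o : option A) : isSome o -> A :=
  match o return isSome o -> A with
  | Some x => fun=> x
  | None => fun h => False_rect A (notF h)
  end.

(* Partial functions are option-valued. The action sets Sigma and T, being     *)
(* distinct types, are disjoint.                                               *)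
Record mdp (R : realType) (S Sigma T : finType) := MDP {
  mdpE : S -> Sigma -> option {ffun T -> S};
  mdpD : S -> Sigma -> option (distr R T);
  mdp_dom : forall s a, isSome (mdpD s a) = isSome (mdpE s a);
  mdp_enabled : forall s, exists a, isSome (mdpE s a)
}.

Definition step (R : realType) (S Sigma T : finType) (M : mdp R S Sigma T)
    (s : S) (a : Sigma) (t : T) : option S :=
  omap (fun f : {ffun T -> S} => f t) (mdpE M s a).

Definition has_glb (disp : Order.disp_t) (S : porderType disp) (x y : S) :=
  exists g : S, [/\ (g <= x)%O, (g <= y)%O &
    forall z : S, (z <= x)%O -> (z <= y)%O -> (z <= g)%O].

Definition monotonic (R : realType) (disp : Order.disp_t)
    (S : finPOrderType disp) (Sigma T : finType) (M : mdp R S Sigma T) : Prop :=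
  (forall x y : S, has_glb x y) /\
  (forall s s' : S, (s <= s')%O -> forall (a : Sigma) (tau : T) (t' : S),
     step M s' a tau = Some t' ->
     exists2 t : S, step M s a tau = Some t & (t <= t')%O).

Record strategy (R : realType) (S Sigma T : finType) (M : mdp R S Sigma T) :=
  Strategy {
    strat :> S -> Sigma;
    stratP : forall s, isSome (mdpE M s (strat s))
  }.

Section Split.
Variables (R : realType) (S Sigma T : finType) (M : mdp R S Sigma T).
Variable lam : strategy M.

Lemma stratDP s : isSome (mdpD M s (lam s)).
Proof. by rewrite mdp_dom stratP. Qed.

Definition E_ (s : S) : {ffun T -> S} := oget (stratP lam s).

Definition D_ (s : S) : distr R T := oget (stratDP s).

Definition P_ (s : S) (C : {set S}) : R := \sum_(t | E_ s t \in C) D_ s t.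

Definition Pre (C : {set S}) (t : T) : {set S} := [set s | E_ s t \in C].

Definition partD : {set {set S}} := preim_partition D_ [set: S].

(* The distribution common to a class X is read off at an arbitrary element;   *)
(* the default 0 is unreachable, since no X in partD is empty.                 *)
Definition class_mass (X : {set S}) (t : T) : R :=
  if [pick s in X] is Some s then D_ s t else 0.

Definition table := {fmap R -> {set S}}.

(* An absent key counts as mapped to the empty set. *)
Definition tget (P : table) (p : R) : {set S} := odflt set0 P.[? p]%fmap.

Definition tadd (P : table) (p : R) (X : {set S}) : table :=
  P.[p <- tget P p :|: X]%fmap.

Definition tclean (P : table) : table :=
  P.[& [fset p in domf P | tget P p != set0]%fset]%fmap.

Definition split_entry (C : {set S}) (t : T) (p : R) (block : {set S})
    (Pnew : table) : table :=
  foldl (fun Q X => tadd Q (p + class_mass X t) (block :&: X :&: Pre C t))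
        (tadd Pnew p (block :\: Pre C t))
        (enum partD).

Definition split_round (C : {set S}) (P : table) (t : T) : table :=
  tclean (foldl (fun Q p => split_entry C t p (tget P p) Q)
                [fmap]%fmap (enum_fset (domf P))).

Definition split_table (B C : {set S}) (tau : seq T) : table :=
  foldl (split_round C) [fmap].[0 <- B]%fmap tau.

Definition Split_alg (B C : {set S}) (tau : seq T) : {set {set S}} :=
  [set X : {set S} | X \in codomf (split_table B C tau)].

End Split.

(* Main.v *)
Require Import Defs.
From mathcomp Require Import all_boot all_order all_algebra.
From mathcomp Require Import finmap reals.

(** A round of the algorithm on the action [t] moves every state [s] from the
    key [p] to the key [p + D_ s t] if [E_ s t \in C], and leaves it at [p]
    otherwise. Starting from the key [0], a state of [B] therefore ends up at
    the key [P_ s C], so that the stored sets are the fibres of [P_ _ C] on [B].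
    None of them is empty because every round ends with a cleaning step. *)

Set Implicit Arguments.
Unset Strict Implicit.

Import GRing.Theory.

Lemma has_foldl (A U : Type) (g : U -> A -> U) (b : pred U) (a : pred A) :
    (forall u x, b (g u x) = b u || a x) ->
  forall u xs, b (foldl g u xs) = b u || has a xs.
Proof.
move=> bg u xs; elim: xs u => [|x xs IHxs] u /=; first by rewrite orbF.
by rewrite IHxs bg orbA.
Qed.

Lemma has_enum_partition (T : finType) (P : {set {set T}}) (D : {set T})
    (x : T) (a : pred {set T}) :
    partition P D -> x \in D ->
  has (fun X : {set T} => (x \in X) && a X) (enum P) = a (pblock P x).
Proof.
move=> partP Dx; have [/eqP coverP tiP _] := and3P partP.
have Px : x \in cover P by rewrite coverP.
apply/hasP/idP => [[X]|a_x].
  by rewrite mem_enum => PX /andP[Xx]; rewrite (def_pblock tiP PX Xx).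
by exists (pblock P x); rewrite ?mem_enum ?pblock_mem // mem_pblock Px.
Qed.

Lemma preim_partition_eqP (T : finType) (rT : eqType) (f : T -> rT)
    (A : {set T}) (x y : T) : x \in A -> y \in A ->
  (exists X, [/\ X \in preim_partition f A, x \in X & y \in X]) <-> f x = f y.
Proof.
move=> Ax Ay; split=> [[_ [/imsetP[z _ ->]]]|fxy].
  by rewrite !inE => /andP[_ /eqP<-] /andP[_ /eqP].
exists [set z in A | f x == f z].
by split; [exact: imset_f | rewrite inE Ax eqxx | rewrite inE Ay fxy eqxx].
Qed.

Section Tables.

Variables (R : realType) (S : finType).
Implicit Types (P : table R S) (B X : {set S}) (s : S) (p q : R).

Lemma in_tget_tadd P p X s q :
  (s \in tget (tadd P p X) q) = (s \in tget P q) || (q == p) && (s \in X).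
Proof.
rewrite {1}/tget /tadd fnd_set; case: eqP => [->|_] /=; last by rewrite orbF.
by rewrite inE.
Qed.

Lemma in_tget_domf P s q : s \in tget P q -> q \in domf P.
Proof. by rewrite /tget; case: fndP => //=; rewrite inE. Qed.

Lemma tget_codomfP P X :
  X != set0 -> reflect (exists q, tget P q = X) (X \in codomf P).
Proof.
move=> X0; apply: (iffP (codomfP _ _)) => -[q].
  by move=> Pq; exists q; rewrite /tget Pq.
rewrite /tget; case Pq: (P.[? q])%fmap => [Y|] /= YX.
  by exists q; rewrite Pq YX.
by rewrite -YX eqxx in X0.
Qed.

Lemma tget_tclean P q : tget (tclean P) q = tget P q.
Proof.
rewrite {1}/tget /tclean fnd_restrict !inE /=.
case: ifPn => //; rewrite negb_and negbK => /orP[qP|/eqP-> //].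
by rewrite /tget not_fnd.
Qed.

Lemma set0_notin_codomf_tclean P : set0 \notin codomf (tclean P).
Proof.
apply/codomfPn => q; rewrite /tclean fnd_restrict !inE /= /tget.
by case: fndP => //= qP; case: ifP.
Qed.

Lemma codomf_fibres P B (f : S -> R) :
    (forall s q, (s \in tget P q) = (s \in B) && (q == f s)) ->
    set0 \notin codomf P ->
  [set X : {set S} | X \in codomf P] = preim_partition f B.
Proof.
move=> Pf P0; have tget_f s : tget P (f s) = [set s' in B | f s == f s'].
  by apply/setP => s'; rewrite Pf inE.
apply/setP => X; rewrite inE; apply/idP/imsetP => [PX|[s Bs ->]].
  have X0 : X != set0 by apply: contraNneq P0 => <-.
  have /(tget_codomfP _ X0)[q Pq] := PX; have /set0Pn[s] := X0.
  by rewrite -Pq Pf => /andP[Bs /eqP->]; exists s.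
apply/tget_codomfP; last by exists (f s).
by apply/set0Pn; exists s; rewrite !inE Bs eqxx.
Qed.

End Tables.

Section SplitCorrectness.

Local Open Scope ring_scope.

Variables (R : realType) (S Sigma T : finType) (M : mdp R S Sigma T).
Variable lam : strategy M.
Implicit Types (P Q : table R S) (B C X : {set S}) (s : S) (t : T).
Implicit Types (ts : seq T) (p q : R).

Definition hit_mass C s t : R := if E_ lam s t \in C then D_ lam s t else 0.

Lemma sum_hit_mass C s ts : uniq ts -> (forall t, t \in ts) ->
  \sum_(t <- ts) hit_mass C s t = P_ lam s C.
Proof.
move=> uniq_ts ts_full; rewrite /P_ [RHS]big_mkcond big_uniq //=.
by apply: eq_bigl => t; rewrite ts_full.
Qed.

Lemma class_mass_pblock s t :
  class_mass lam (pblock (partD lam) s) t = D_ lam s t.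
Proof.
have eqD : {in [set: S] & &, equivalence_rel (fun u v => D_ lam u == D_ lam v)}.
  by split=> // /eqP->.
have in_pblock u : (u \in pblock (partD lam) s) = (D_ lam s == D_ lam u).
  exact: (pblock_equivalence_partition eqD).
rewrite /class_mass; case: pickP => [u|/(_ s)]; rewrite in_pblock.
  by move/eqP->.
by rewrite eqxx.
Qed.

Lemma in_tget_split_entry C t p X Q s q :
  (s \in tget (split_entry lam C t p X Q) q) =
  (s \in tget Q q) || (s \in X) && (q == p + hit_mass C s t).
Proof.
have in_tget_add_class Q' (Y : {set S}) :
    (s \in tget (tadd Q' (p + class_mass lam Y t) (X :&: Y :&: Pre lam C t)) q)
    = (s \in tget Q' q) || (s \in Y) &&
      [&& q == p + class_mass lam Y t, s \in X & s \in Pre lam C t].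
  rewrite in_tget_tadd !inE; congr (_ || _).
  by case: (s \in Y); rewrite ?andbT ?andbF.
rewrite (has_foldl (b := fun Q' => s \in tget Q' q) in_tget_add_class).
rewrite (has_enum_partition _ (preim_partitionP _ _)) ?inE //.
rewrite class_mass_pblock in_tget_tadd !inE /hit_mass -orbA; congr (_ || _).
by case: (E_ lam s t \in C); rewrite ?addr0 ?andbT ?andbF ?orbF 1?andbC.
Qed.

Lemma in_tget_split_round C P t s q :
  (s \in tget (split_round lam C P t) q) =
  (s \in tget P (q - hit_mass C s t)).
Proof.
rewrite tget_tclean (has_foldl (b := fun Q => s \in tget Q q)
  (fun Q p => in_tget_split_entry C t p (tget P p) Q s q)).
rewrite {1}/tget fnd_fmap0 inE /=.
apply/hasP/idP => [[p _ /andP[sPp /eqP->]]|sP]; first by rewrite addrK.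
exists (q - hit_mass C s t); first exact: in_tget_domf sP.
by rewrite sP subrK eqxx.
Qed.

Lemma in_tget_foldl_split_round C P ts s q :
  (s \in tget (foldl (split_round lam C) P ts) q) =
  (s \in tget P (q - \sum_(t <- ts) hit_mass C s t)).
Proof.
elim: ts P => [|t ts IHts] P /=; first by rewrite big_nil subr0.
by rewrite IHts in_tget_split_round big_cons opprD addrAC addrA.
Qed.

Lemma in_tget_split_table B C ts s q :
  (s \in tget (split_table lam B C ts) q) =
  (s \in B) && (q == \sum_(t <- ts) hit_mass C s t).
Proof.
rewrite in_tget_foldl_split_round /tget fnd_set fnd_fmap0 subr_eq0.
by case: eqP; rewrite ?andbT ?andbF ?inE.
Qed.

Lemma set0_notin_codomf_split_table B C ts :
  (0 < size ts)%N -> set0 \notin codomf (split_table lam B C ts).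
Proof.
case/lastP: ts => // ts t _; rewrite /split_table foldl_rcons.
exact: set0_notin_codomf_tclean.
Qed.

Lemma Split_algE B C ts :
    (0 < size ts)%N -> uniq ts -> (forall t, t \in ts) ->
  Split_alg lam B C ts = preim_partition (fun s => P_ lam s C) B.
Proof.
move=> ts_gt0 uniq_ts ts_full.
apply: codomf_fibres; last exact: set0_notin_codomf_split_table.
by move=> s q; rewrite in_tget_split_table sum_hit_mass.
Qed.

End SplitCorrectness.

Theorem theorem1 (R : realType) (disp : Order.disp_t) (S : finPOrderType disp)
    (Sigma T : finType) (M : mdp R S Sigma T) (hM : monotonic M)
    (m : nat) (hm : 0 < m) (tau : m.-tuple T) (tau_uniq : uniq tau)
    (tau_full : forall t : T, t \in tau)
    (lam : strategy M) (B C : {set S}) :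
  partition (Split_alg lam B C tau) B /\
  forall s s' : S, s \in B -> s' \in B ->
    ((exists Bl : {set S},
        [/\ Bl \in Split_alg lam B C tau, s \in Bl & s' \in Bl])
     <-> P_ lam s C = P_ lam s' C).
Proof.
rewrite Split_algE ?size_tuple //; split; first exact: preim_partitionP.
by move=> s s'; exact: preim_partition_eqP.
Qed.
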